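(* Let $\Omega=\Omega_1\times\cdots\times\Omega_n$ be a product of finite probability spaces $(\Omega_i,\mu_i)$ with product probability measure $\mu=\mu_1\otimes\cdots\otimes\mu_n$, each factor being endowed with the Markov operator $L_if=\int_{\Omega_i}f\,d\mu_i-f$, and suppose that the product semigroup $(P_t)_{t\ge0}$ generated by $L=\sum_{i=1}^nL_i$ is hypercontractive with constant $\rho>0$. Let $f:\Omega\to\mathbb{R}$ with $f\in L^2(\mu)$. Then, for $\eta\in[0,1)$, $$ \mathcal{S}_\eta(f)\;\le\;7\left(\sum_{i=1}^n\|L_if\|_1^2\right)^{\alpha(\eta)}\|f\|_2^{2-2\alpha(\eta)}, $$ where $$ \alpha(\eta)=\frac{1-(1-\eta)^{\rho/2}}{2}\;\ge\;\frac{\rho}{4}\,\eta . $$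
   Context: For $f:\Omega\to\mathbb{R}$, $L_if=\int_{\Omega_i}f\,d\mu_i-f$, where the integration is in the $i$-th coordinate only, the others being fixed. $P_t=e^{tL}$, with Dirichlet form $\mathcal{E}(f,f)=\int_\Omega f(-Lf)\,d\mu=\sum_{i=1}^n\int_\Omega(L_if)^2d\mu$. Norms $\|\cdot\|_p$ are those of $L^p(\mu)$, and $\mathrm{Var}_\mu(f)=\int f^2d\mu-(\int f\,d\mu)^2$. Hypercontractive with constant $\rho>0$: for all $t>0$ and all $1<p<q<\infty$ with $p\ge1+(q-1)e^{-2\rho t}$, one has $\|P_tf\|_q\le\|f\|_p$ for all $f\in L^p(\mu)$. Equivalently, the logarithmic Sobolev inequality $\rho\,\mathrm{Ent}_\mu(f^2)\le2\,\mathcal{E}(f,f)$ holds for all $f$, where $\mathrm{Ent}_\mu(g)=\int g\log g\,d\mu-\int g\,d\mu\,\log\int g\,d\mu$ for $g\ge 0$. The spectral gap constant of this model is $\lambda=1$, so the noise stability is $\mathcal{S}_\eta(f)=\mathrm{Var}_\mu(P_tf)$ where $t\ge0$ is defined by $e^{-2t}=1-\eta$.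
   Formalization: The lower bound α(η) ≥ ρη/4 is claimed only when μ is not a point mass (where the spectral gap is 1): for a point mass every ρ>0 is a hypercontractivity constant and the bound fails, e.g. ρ=4, η=1/2 gives α=3/8<1/2. *)

(* Defs.v *)
From HB Require Import structures.
From mathcomp Require Import all_boot all_order all_algebra.
From mathcomp Require Import all_classical all_reals all_analysis.

Set Implicit Arguments.
Unset Strict Implicit.
Unset Printing Implicit Defensive.

Import Order.TTheory GRing.Theory Num.Theory.
Import numFieldNormedType.Exports.

Local Open Scope ring_scope.

Definition is_prob (R : realType) (T : finType) (m : T -> R) : Prop :=
  (forall x, 0 <= m x) /\ \sum_x m x = 1.

Definition Omega (n : nat) (T : 'I_n -> finType) : finType :=
  {dffun forall i : 'I_n, T i}.

Definition upd (n : nat) (T : 'I_n -> finType) (x : Omega T) (i : 'I_n)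
    (y : T i) : Omega T :=
  [ffun j : 'I_n => dfwith (fun k => x k) i y j].

Definition prod_mass (R : realType) (n : nat) (T : 'I_n -> finType)
    (mu : forall i, T i -> R) (x : Omega T) : R :=
  \prod_i mu i (x i).

Definition prod_mean (R : realType) (n : nat) (T : 'I_n -> finType)
    (mu : forall i, T i -> R) (f : Omega T -> R) : R :=
  \sum_x prod_mass mu x * f x.

Definition Lpnorm (R : realType) (n : nat) (T : 'I_n -> finType)
    (mu : forall i, T i -> R) (p : R) (f : Omega T -> R) : R :=
  (prod_mean mu (fun x => `|f x| `^ p)) `^ p^-1.

Definition prod_var (R : realType) (n : nat) (T : 'I_n -> finType)
    (mu : forall i, T i -> R) (f : Omega T -> R) : R :=
  prod_mean mu (fun x => f x ^+ 2) - prod_mean mu f ^+ 2.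

Definition Lcoord (R : realType) (n : nat) (T : 'I_n -> finType)
    (mu : forall i, T i -> R) (i : 'I_n) (f : Omega T -> R) : Omega T -> R :=
  fun x => \sum_(y : T i) mu i y * f (upd x y) - f x.

Definition Lgen (R : realType) (n : nat) (T : 'I_n -> finType)
    (mu : forall i, T i -> R) (f : Omega T -> R) : Omega T -> R :=
  fun x => \sum_i Lcoord mu i f x.

(* e^{tL} f as the exponential series \sum_k t^k/k! L^k f, which converges
   pointwise since L is a linear operator on a finite-dimensional space. *)
Definition semigroup (R : realType) (n : nat) (T : 'I_n -> finType)
    (mu : forall i, T i -> R) (t : R) (f : Omega T -> R) : Omega T -> R :=
  fun x => limn (series (fun k => exp_coeff t k * iter k (Lgen mu) f x)).

Definition hypercontractive (R : realType) (n : nat) (T : 'I_n -> finType)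
    (mu : forall i, T i -> R) (rho : R) : Prop :=
  forall t p q : R, 0 < t -> 1 < p -> p < q ->
    1 + (q - 1) * expR (- (2 * rho * t)) <= p ->
    forall f : Omega T -> R,
      Lpnorm mu q (semigroup mu t f) <= Lpnorm mu p f.

Definition noise_time (R : realType) (eta : R) : R := - ln (1 - eta) / 2.

Lemma noise_timeP (R : realType) (eta t : R) : 0 <= eta -> eta < 1 ->
  (0 <= t /\ expR (- (2 * t)) = 1 - eta) <-> t = noise_time eta.
Proof.
move=> eta0 eta1; have h : 0 < 1 - eta by rewrite subr_gt0.
have two0 : (2 : R) != 0 by rewrite pnatr_eq0.
rewrite /noise_time; split=> [[_ <-]|->].
  by rewrite expRK opprK mulrC mulKf.
split; last by rewrite mulrC divfK // opprK lnK.
by rewrite divr_ge0 // oppr_ge0 ln_le0 // gerBl.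
Qed.

Definition noise_stability (R : realType) (n : nat) (T : 'I_n -> finType)
    (mu : forall i, T i -> R) (eta : R) (f : Omega T -> R) : R :=
  prod_var mu (semigroup mu (noise_time eta) f).

(* Fails only when the product measure is a point mass.  In that case every
   rho > 0 is a hypercontractivity constant and the spectral gap constant is
   not 1, because the Poincare inequality holds with any constant. *)
Definition not_point_mass (R : realType) (n : nat) (T : 'I_n -> finType)
    (mu : forall i, T i -> R) : Prop :=
  exists g : Omega T -> R, prod_var mu g != 0.

Definition noise_exponent (R : realType) (rho eta : R) : R :=
  (1 - (1 - eta) `^ (rho / 2)) / 2.

(* Main.v *)
(* Let h_i = L_i E[f | x_1, ..., x_i]; up to sign these are the martingale
   differences of f.  Since P_t commutes with L_i and with conditional
   expectations, orthogonality gives Var(P_t f) = sum_i |P_t h_i|_2^2, and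
   hypercontractivity bounds |P_t h_i|_2 by |h_i|_p with p = 1 + e^(-2 rho t).
   Interpolating L^p between L^1 and L^2,
     |h_i|_p^2 <= |h_i|_1^(2 a) |h_i|_2^(2 - 2 a)  for a <= (2 - p) / p,
   and a = (1 - e^(-rho t)) / 2 is such an exponent.  As |h_i|_1 <= |L_i f|_1 and
   sum_i |h_i|_2^2 = Var(f), Hoelder's inequality for the sum over i yields the
   bound with constant 1 instead of 7.

   The lower bound on the exponent is Bernoulli's inequality once rho <= 1 is
   known.  For the latter, apply hypercontractivity from L^(1 + e^(-2 rho t)) to
   L^2 to 1 - h, where h has values in [-1, 1] and L h = - h: this gives
   e^(-2 t) <= 3 e^(-2 rho t) for all t > 0. *)
Require Import Defs.
From HB Require Import structures.
From mathcomp Require Import all_boot all_order all_algebra.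
From mathcomp Require Import all_classical all_reals all_analysis.
From mathcomp Require Import ring lra.

Import Order.TTheory GRing.Theory Num.Theory.
Import numFieldNormedType.Exports.

Local Open Scope ring_scope.

(** * Coordinate averages and the semigroup *)

Section Updates.
Context {n : nat} {T : 'I_n -> finType}.
Implicit Types x z : Omega T.

Lemma upd_same x i (y : T i) : upd x y i = y.
Proof. by rewrite ffunE dfwithin. Qed.

Lemma upd_other x i (y : T i) j : i != j -> upd x y j = x j.
Proof. by move=> ij; rewrite ffunE dfwithout. Qed.

Lemma updK x i (y z : T i) : upd (upd x y) z = upd x z.
Proof.
apply/ffunP => j; case: (eqVneq i j) => [e|ij]; last by rewrite !upd_other.
by case: j / e; rewrite !upd_same.
Qed.

Lemma updI x i : upd x (x i) = x.
Proof.
apply/ffunP => j; case: (eqVneq i j) => [e|ij]; last by rewrite !upd_other.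
by case: j / e; rewrite !upd_same.
Qed.

Lemma updC x i j (y : T i) (z : T j) : i != j ->
  upd (upd x y) z = upd (upd x z) y.
Proof.
move=> ij; have ji : j != i by rewrite eq_sym.
apply/ffunP => k; case: (eqVneq i k) => [e|ik].
  by case: k / e; rewrite upd_same upd_other // upd_same.
rewrite (upd_other (upd x z)) //; case: (eqVneq j k) => [e|jk].
  by case: k / e ik => ik; rewrite !upd_same.
by rewrite !upd_other.
Qed.

(** Overwriting the coordinates of [x] one at a time by those of [z] ends at [z]. *)
Lemma upd_invariant_cst {A : Type} (F : Omega T -> A) :
  (forall i x (y : T i), F (upd x y) = F x) -> forall x z, F x = F z.
Proof.
move=> Finv x z.
have Fs s : F (foldr (fun i w => upd w (z i)) x s) = F x.
  by elim: s => //= i s IH; rewrite Finv.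
rewrite -(Fs (enum 'I_n)); congr F; apply/ffunP => j.
have : j \in enum 'I_n by rewrite mem_enum.
elim: (enum 'I_n) => //= i s IH; rewrite in_cons.
case: (eqVneq i j) => [e|ij]; first by case: j / e {IH}; rewrite upd_same.
by rewrite upd_other // eq_sym (negPf ij).
Qed.

End Updates.

(** Conditional expectation given all coordinates but [i], named so that [Lcoord mu i] is this
    operator minus the identity. *)
Definition Ecoord {R : realType} {n : nat} {T : 'I_n -> finType}
    (mu : forall i, T i -> R) (i : 'I_n) (f : Omega T -> R) : Omega T -> R :=
  fun x => \sum_(y : T i) mu i y * f (upd x y).

Section ProductMean.
Context {R : realType} {n : nat} {T : 'I_n -> finType}.
Variables (mu : forall i, T i -> R).
Hypothesis mu_prob : forall i, is_prob (mu i).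
Implicit Types (f g : Omega T -> R).

Lemma mu_ge0 i (y : T i) : 0 <= mu i y.
Proof. by have [] := mu_prob i. Qed.

Lemma prod_mass_ge0 x : 0 <= prod_mass mu x.
Proof. by apply: prodr_ge0 => i _; exact: mu_ge0. Qed.

(** Distributivity expands the product of the total masses. As the factors have different types, the
    expansion passes through functions into their tagged union. *)
Lemma sum_prod_mass : \sum_x prod_mass mu x = 1.
Proof.
transitivity (\prod_i \sum_y mu i y); last first.
  by rewrite big1 // => i _; have [] := mu_prob i.
rewrite (reindex (@dffun_of_fprod _ T)); last exact/onW_bij/dffun_of_fprod_bij.
have := @big_fprod R 0 1 *%R +%R _ T (fun i => [ffun y => mu i y]).
rewrite (eq_bigr (fun t => prod_mass mu (dffun_of_fprod t))); last first.
  by move=> t _; apply: eq_bigr => i _; rewrite !ffunE.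
move=> ->; under [RHS]eq_bigr => i _ do rewrite (@big_tag _ _ _ _ T mu).
rewrite bigA_distr_big_dep; apply: eq_bigr => g _; apply: eq_bigr => i _.
by rewrite /untag; case: eqP => // e; rewrite ffunE.
Qed.

Local Notation M := (prod_mean mu).
Local Notation E := (Ecoord mu).

Lemma prod_meanD f g : M (fun x => f x + g x) = M f + M g.
Proof. by rewrite -big_split; apply: eq_bigr => x _; rewrite mulrDr. Qed.

Lemma prod_meanZ c f : M (fun x => c * f x) = c * M f.
Proof. by rewrite mulr_sumr; apply: eq_bigr => x _; rewrite mulrCA. Qed.

Lemma prod_meanB f g : M (fun x => f x - g x) = M f - M g.
Proof.
rewrite -[- M g]mulN1r -prod_meanZ -prod_meanD.
by apply: eq_bigr => x _; rewrite mulN1r.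
Qed.

Lemma prod_mean_cst c : M (fun=> c) = c.
Proof. by rewrite /prod_mean -mulr_suml sum_prod_mass mul1r. Qed.

Lemma le_prod_mean f g : (forall x, f x <= g x) -> M f <= M g.
Proof. by move=> fg; apply: ler_sum => x _; rewrite ler_wpM2l ?prod_mass_ge0. Qed.

Lemma prod_mean_ge0 f : (forall x, 0 <= f x) -> 0 <= M f.
Proof. by move=> f0; rewrite -[leLHS](prod_mean_cst 0); exact: le_prod_mean. Qed.

(** Only the [i]-th factor of the mass changes. The relation is kept free of division because
    [mu i (x i)] may be zero. *)
Lemma prod_mass_upd x i (y : T i) :
  prod_mass mu (upd x y) * mu i (x i) = prod_mass mu x * mu i y.
Proof.
rewrite /prod_mass (bigD1 i) //= [in RHS](bigD1 i) //= upd_same.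
rewrite mulrAC [RHS]mulrAC [mu i y * _]mulrC; congr (_ * _).
by apply: eq_bigr => j ji; rewrite upd_other // eq_sym.
Qed.

(* Swapping the i-th entry of [x] with an independent copy [y] is a
   measure-preserving involution. *)
Lemma prod_mean_Ecoord i f : M (E i f) = M f.
Proof.
transitivity (\sum_(p : Omega T * T i) prod_mass mu p.1 * mu i p.2 * f p.1).
  rewrite /prod_mean /Ecoord (eq_bigr (fun x : Omega T => \sum_(y : T i)
    prod_mass mu x * mu i y * f (upd x y))); last first.
    by move=> x _; rewrite mulr_sumr; apply: eq_bigr => y _; rewrite mulrA.
  rewrite pair_big /=.
  pose swap (p : Omega T * T i) := (upd p.1 p.2, p.1 i).
  have swapK : involutive swap.
    by case=> x y; rewrite /swap /= updK updI upd_same.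
  rewrite [RHS](reindex swap) /=; last by apply/onW_bij/(Bijective swapK swapK).
  by apply: eq_bigr => -[x y] _; rewrite /= prod_mass_upd.
rewrite -(pair_big xpredT xpredT
  (fun (x : Omega T) (y : T i) => prod_mass mu x * mu i y * f x)) /=.
apply: eq_bigr => x _; rewrite -mulr_suml -mulr_sumr.
by have [_ ->] := mu_prob i; rewrite mulr1.
Qed.

Lemma Ecoord_upd i f x (y : T i) : E i f (upd x y) = E i f x.
Proof. by apply: eq_bigr => z _; rewrite updK. Qed.

Lemma Ecoord_mull i f g : (forall x (y : T i), g (upd x y) = g x) ->
  forall x, E i (fun x => f x * g x) x = E i f x * g x.
Proof.
move=> gi x; rewrite /Ecoord mulr_suml; apply: eq_bigr => y _.
by rewrite gi mulrA.
Qed.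

Lemma Ecoord_invariant i f : (forall x (y : T i), f (upd x y) = f x) ->
  E i f = f.
Proof.
move=> fi; apply/funext => x; rewrite /Ecoord.
under eq_bigr do rewrite fi.
by rewrite -mulr_suml; have [_ ->] := mu_prob i; rewrite mul1r.
Qed.

Lemma EcoordC i j f : E i (E j f) = E j (E i f).
Proof.
case: (eqVneq i j) => [->//|ij]; apply/funext => x; rewrite /Ecoord.
under eq_bigr do rewrite mulr_sumr.
under [RHS]eq_bigr do rewrite mulr_sumr.
rewrite exchange_big; apply: eq_bigr => z _; apply: eq_bigr => y _.
by rewrite mulrCA updC.
Qed.

Lemma EcoordB i f g : E i (fun x => f x - g x) = fun x => E i f x - E i g x.
Proof.
apply/funext => x; rewrite /Ecoord -sumrB; apply: eq_bigr => y _.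
by rewrite mulrBr.
Qed.

Lemma LcoordE i f : Lcoord mu i f = fun x => E i f x - f x.
Proof. by []. Qed.

Lemma Ecoord_Lcoord i j f : E i (Lcoord mu j f) = Lcoord mu j (E i f).
Proof. by rewrite !LcoordE EcoordB EcoordC. Qed.

Lemma Ecoord_Lgen i f : E i (Lgen mu f) = Lgen mu (E i f).
Proof.
apply/funext => x; rewrite /Lgen /Ecoord.
under eq_bigr do rewrite mulr_sumr.
rewrite exchange_big; apply: eq_bigr => j _.
by rewrite -[LHS]/(E i (Lcoord mu j f) x) Ecoord_Lcoord.
Qed.

Lemma Ecoord_iter_Lgen i k f : E i (iter k (Lgen mu) f) = iter k (Lgen mu) (E i f).
Proof. by elim: k => //= k IH; rewrite Ecoord_Lgen IH. Qed.

Lemma LgenB f g : Lgen mu (fun x => f x - g x) = fun x => Lgen mu f x - Lgen mu g x.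
Proof.
apply/funext => x; rewrite /Lgen -sumrB; apply: eq_bigr => i _.
by rewrite !LcoordE EcoordB; ring.
Qed.

Lemma iter_LgenB k f g : iter k (Lgen mu) (fun x => f x - g x) =
  fun x => iter k (Lgen mu) f x - iter k (Lgen mu) g x.
Proof. by elim: k => //= k ->; rewrite LgenB. Qed.

(** * Sup-norm bounds and the exponential series of the generator *)

Lemma norm_Ecoord i f x : `|E i f x| <= E i (fun x => `|f x|) x.
Proof.
apply: (le_trans (ler_norm_sum _ _ _)); apply: ler_sum => y _.
by rewrite normrM ger0_norm ?mu_ge0.
Qed.

(** Each of the [n] operators [Lcoord] is a difference of two sup-norm contractions. *)
Lemma norm_Lgen_le f c : (forall x, `|f x| <= c) ->
  forall x, `|Lgen mu f x| <= (2 * n)%:R * c.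
Proof.
move=> fc x; apply: (le_trans (ler_norm_sum _ _ _)).
have -> : (2 * n)%:R * c = \sum_(i < n) c *+ 2.
  by rewrite sumr_const card_ord -mulrnA mulr_natl.
apply: ler_sum => i _.
rewrite LcoordE mulr2n; apply: (le_trans (ler_normB _ _)); rewrite lerD //.
apply: (le_trans (norm_Ecoord _ _ _)).
apply: (@le_trans _ _ (\sum_y mu i y * c)).
  by apply: ler_sum => y _; rewrite ler_wpM2l ?mu_ge0.
by rewrite -mulr_suml; have [_ ->] := mu_prob i; rewrite mul1r.
Qed.

Lemma norm_iter_Lgen_le f c : (forall x, `|f x| <= c) ->
  forall k x, `|iter k (Lgen mu) f x| <= (2 * n)%:R ^+ k * c.
Proof.
move=> fc; elim=> [|k IH] x /=; first by rewrite expr0 mul1r.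
by rewrite exprS -mulrA; apply: norm_Lgen_le.
Qed.

(** The terms are dominated by those of the exponential series at [2 n t], times a bound on [f].
    Hence the [limn] in [semigroup] is a genuine limit. *)
Lemma semigroup_cvg t f x : 0 <= t ->
  (series (fun k => exp_coeff t k * iter k (Lgen mu) f x) @ \oo -->
   semigroup mu t f x)%classic.
Proof.
move=> t0; apply: normed_cvg.
pose c := \sum_z `|f z|.
have fc z : `|f z| <= c by rewrite /c (bigD1 z) //= lerDl sumr_ge0.
apply: (@series_le_cvg _ _ (c *: exp_coeff ((2 * n)%:R * t))) => [k|k|k|].
- exact: normr_ge0.
- rewrite mulr_ge0 ?exp_coeff_ge0 ?mulr_ge0 //.
  exact: le_trans (normr_ge0 _) (fc x).
- rewrite /= normrM ger0_norm ?exp_coeff_ge0 //= /exp_coeff.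
  rewrite -[leRHS]/(c * (((2 * n)%:R * t) ^+ k / k`!%:R)) exprMn.
  apply: (@le_trans _ _ (t ^+ k / k`!%:R * ((2 * n)%:R ^+ k * c))).
    rewrite ler_wpM2l ?norm_iter_Lgen_le //.
    by rewrite divr_ge0 ?exprn_ge0 ?ler0n.
  by rewrite le_eqVlt; apply/orP; left; apply/eqP; ring.
- exact/is_cvg_seriesZ/is_cvg_series_exp_coeff.
Qed.

Lemma semigroup_eqP t f x l :
  (series (fun k => exp_coeff t k * iter k (Lgen mu) f x) @ \oo --> l)%classic ->
  semigroup mu t f x = l.
Proof. exact: (cvg_lim (@Rhausdorff R)). Qed.

Lemma semigroupB t f g : 0 <= t -> semigroup mu t (fun x => f x - g x) =
  fun x => semigroup mu t f x - semigroup mu t g x.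
Proof.
move=> t0; apply/funext => x; apply: semigroup_eqP.
apply: cvg_trans (cvgB (semigroup_cvg t f x t0) (semigroup_cvg t g x t0)).
apply: near_eq_cvg; near=> N.
rewrite !fctE /series /= -sumrB; apply: eq_bigr => k _.
by rewrite iter_LgenB mulrBr.
Unshelve. all: by end_near. Qed.

(** [Ecoord] is a finite sum, so it passes through the limit, and it commutes with all powers of the
    generator. *)
Lemma semigroup_Ecoord t i f : 0 <= t ->
  semigroup mu t (E i f) = E i (semigroup mu t f).
Proof.
move=> t0; apply/funext => x; apply: semigroup_eqP.
have : ((fun N => \sum_y mu i y *
    series (fun k => exp_coeff t k * iter k (Lgen mu) f (upd x y)) N) @ \oo
    --> E i (semigroup mu t f) x)%classic.
  apply: cvg_big => [|y _]; first exact: add_continuous.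
  exact: cvgMl_tmp (semigroup_cvg t f (upd x y) t0).
move=> h; apply: cvg_trans h; apply: near_eq_cvg; near=> N.
rewrite /series /=; under eq_bigr do rewrite mulr_sumr.
rewrite exchange_big; apply: eq_bigr => k _; rewrite -Ecoord_iter_Lgen mulr_sumr.
by apply: eq_bigr => y _; rewrite mulrCA.
Unshelve. all: by end_near. Qed.

Lemma semigroup_Lcoord t i f : 0 <= t ->
  semigroup mu t (Lcoord mu i f) = Lcoord mu i (semigroup mu t f).
Proof. by move=> t0; rewrite !LcoordE semigroupB // semigroup_Ecoord. Qed.

Lemma semigroup0 f : semigroup mu 0 f = f.
Proof.
(* After a shift by one, every partial sum contains the term [k = 0], the only one to survive at
   time 0. *)
apply/funext => x; apply: semigroup_eqP; rewrite -(cvg_shiftn 1).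
apply: cvg_near_cst; near=> N; rewrite /series /= addn1 big_nat_recl // big1.
  by rewrite /exp_coeff /= expr0 fact0 divr1 mul1r addr0.
by move=> k _; rewrite /exp_coeff /= exprS mul0r mul0r mul0r.
Unshelve. all: by end_near. Qed.

End ProductMean.

(** * Weighted power inequalities *)

Section PowerInequalities.
Context {R : realType}.
Implicit Types a b s p : R.

(** Young's inequality for the conjugate exponents [1 / s] and [1 / (1 - s)]. *)
Lemma powR_wAMGM a b s : 0 <= a -> 0 <= b -> 0 < s < 1 ->
  a `^ s * b `^ (1 - s) <= s * a + (1 - s) * b.
Proof.
move=> a0 b0 /andP[s0 s1]; have s1' : 0 < 1 - s by rewrite subr_gt0.
have sN0 := lt0r_neq0 s0; have s1'N0 := lt0r_neq0 s1'.
have := @conjugate_powR R (a `^ s) (b `^ (1 - s)) s^-1 (1 - s)^-1.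
rewrite !powR_ge0 !invr_gt0 !invrK s0 s1' -!powRrM !mulfV // !powRr1 //.
by rewrite [s + _]addrC subrK [a * s]mulrC [b * _]mulrC => /(_ isT isT isT isT erefl).
Qed.

(** Bernoulli's inequality for exponents in (0, 1): the case [b = 1] of weighted AM-GM. *)
Lemma powR_le1Dx a s : 0 <= a -> 0 < s < 1 -> a `^ s <= 1 + s * (a - 1).
Proof.
move=> a0 s01; have := powR_wAMGM a 1 s a0 ler01 s01.
by rewrite powR1 !mulr1 mulrBr mulr1 => h; lra.
Qed.

(** Once [a] and [b] are normalised by their weighted sums, Hoelder's inequality is weighted AM-GM
    term by term. It serves both for integrals over [Omega] and for the sum over coordinates. *)
Lemma hoelder_wsum (I : finType) (w a b : I -> R) s :
  (forall i, 0 <= w i) -> (forall i, 0 <= a i) -> (forall i, 0 <= b i) ->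
  0 < s < 1 ->
  \sum_i w i * (a i `^ s * b i `^ (1 - s)) <=
    (\sum_i w i * a i) `^ s * (\sum_i w i * b i) `^ (1 - s).
Proof.
move=> w0 a0 b0 s01; have /andP[s0 s1] := s01.
have sN0 := lt0r_neq0 s0.
have s1'N0 : 1 - s != 0 by rewrite lt0r_neq0 // subr_gt0.
set A := \sum_i w i * a i; set B := \sum_i w i * b i.
have waN0 i : 0 <= w i * a i by rewrite mulr_ge0.
have wbN0 i : 0 <= w i * b i by rewrite mulr_ge0.
(* If a weighted sum vanishes, so do all its terms, and both sides are 0 because 0 to a nonzero
   power is 0. *)
have [A0|A_neq0] := eqVneq A 0.
  rewrite A0 powR0 // mul0r big1 // => i _.
  have /eqP := psumr_eq0P (fun i _ => waN0 i) A0 (erefl : xpredT i).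
  by rewrite mulf_eq0 => /orP[/eqP->|/eqP->]; rewrite ?mul0r // powR0 // mul0r mulr0.
have [B0|B_neq0] := eqVneq B 0.
  rewrite B0 (powR0 s1'N0) mulr0 big1 // => i _.
  have /eqP := psumr_eq0P (fun i _ => wbN0 i) B0 (erefl : xpredT i).
  rewrite mulf_eq0 => /orP[/eqP->|/eqP->]; rewrite ?mul0r //.
  by rewrite (powR0 s1'N0) !mulr0.
have A_ge0 : 0 <= A by exact: sumr_ge0.
have B_ge0 : 0 <= B by exact: sumr_ge0.
set C := A `^ s * B `^ (1 - s).
have -> : C = \sum_i w i * (C * (s * (a i / A) + (1 - s) * (b i / B))).
  transitivity (C * (s * (A / A) + (1 - s) * (B / B))).
    by rewrite !divff // !mulr1 addrC subrK mulr1.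
  rewrite {1}/A {1}/B !mulr_suml !mulr_sumr -big_split mulr_sumr.
  by apply: eq_bigr => i _ /=; move: C A^-1 B^-1 => c u v; ring.
apply: ler_sum => i _; rewrite ler_wpM2l //.
have -> : a i `^ s * b i `^ (1 - s) =
    C * ((a i / A) `^ s * (b i / B) `^ (1 - s)).
  rewrite -[in LHS](divfK A_neq0 (a i)) -[in LHS](divfK B_neq0 (b i)).
  rewrite (@powRM _ (a i / A) A) ?divr_ge0 // (@powRM _ (b i / B) B) ?divr_ge0 //.
  by rewrite mulrACA mulrC.
rewrite ler_wpM2l ?mulr_ge0 ?powR_ge0 //.
by apply: powR_wAMGM => //; rewrite divr_ge0.
Qed.

(** The exponents add up to [(2 - p) + 2 (p - 1) = p]. The form [1 - (2 - p)] matches Hoelder with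
    [s = 2 - p]. *)
Lemma powR_split a p : 1 < p -> `|a| `^ p = `|a| `^ (2 - p) * (a ^+ 2) `^ (1 - (2 - p)).
Proof.
move=> p1; rewrite -(real_normK (num_real a)) -(@powR_mulrn _ `|a|) //.
rewrite -powRrM -powRD; last by apply/implyP => /eqP h; lra.
by congr (_ `^ _); ring.
Qed.

(** Here [N], [Y] and [Z] stand for the L^1 norm, the second moment and the [p]-th moment. Raising
    the Hoelder bound to the power [2 / p] gives the claim for the exponent [th]; then [th] is
    lowered to [a]. *)
Lemma powR_interpolation (N Y Z p a : R) :
  1 < p < 2 -> 0 <= a <= (2 - p) / p ->
  0 <= N -> N ^+ 2 <= Y -> 0 <= Z -> Z <= N `^ (2 - p) * Y `^ (1 - (2 - p)) ->
  (Z `^ p^-1) ^+ 2 <= (N ^+ 2) `^ a * Y `^ (1 - a).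
Proof.
move=> /andP[p1 p2] /andP[a0 ap] N0 XY Z0 ZNY; have p0 : 0 < p by lra.
have pN0 := lt0r_neq0 p0.
set th := (2 - p) / p in ap.
have th1 : th < 1 by rewrite /th ltr_pdivrMr //; lra.
have th0 : 0 < th by rewrite /th divr_gt0 //; lra.
have X0 : 0 <= N ^+ 2 by exact: sqr_ge0.
have Y0 : 0 <= Y by exact: le_trans XY.
apply: (@le_trans _ _ ((N ^+ 2) `^ th * Y `^ (1 - th))).
  rewrite -powR_mulrn ?powR_ge0 // -powRrM.
  apply: (@le_trans _ _ ((N `^ (2 - p) * Y `^ (1 - (2 - p))) `^ (p^-1 * 2))).
    apply: ge0_ler_powR => //; rewrite ?nnegrE // mulr_ge0 ?powR_ge0 //.
    by rewrite invr_ge0 ltW.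
  rewrite powRM ?powR_ge0 // -!powRrM -powR_mulrn // -powRrM.
  rewrite (_ : (2 - p) * (p^-1 * 2) = 2 * th); last by rewrite /th; field.
  by rewrite (_ : (1 - (2 - p)) * (p^-1 * 2) = 1 - th) //; rewrite /th; field.
(* The surplus power [th - a] of [N ^+ 2] is bounded by the same power of [Y]. *)
have -> : (N ^+ 2) `^ th = (N ^+ 2) `^ a * (N ^+ 2) `^ (th - a).
  by rewrite -powRD addrC subrK // (negPf (lt0r_neq0 th0)).
rewrite -mulrA ler_wpM2l ?powR_ge0 //.
apply: (@le_trans _ _ (Y `^ (th - a) * Y `^ (1 - th))).
  rewrite ler_wpM2r ?powR_ge0 //; apply: ge0_ler_powR; rewrite ?nnegrE //.
  by rewrite subr_ge0.
rewrite -powRD (_ : th - a + (1 - th) = 1 - a) //; try ring.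
by apply/implyP => /eqP h; lra.
Qed.

End PowerInequalities.

(** * Norms and interpolation between L^1 and L^2 *)

Section Norms.
Context {R : realType} {n : nat} {T : 'I_n -> finType}.
Variables (mu : forall i, T i -> R).
Hypothesis mu_prob : forall i, is_prob (mu i).
Implicit Types (f g h : Omega T -> R).
Local Notation M := (prod_mean mu).

Lemma Lpnorm1E f : Lpnorm mu 1 f = M (fun x => `|f x|).
Proof.
rewrite /Lpnorm invr1 powRr1; last by apply: prod_mean_ge0 => // x; exact: powR_ge0.
by apply: eq_bigr => x _; rewrite powRr1.
Qed.

Lemma Lpnorm2_sqr f : Lpnorm mu 2 f ^+ 2 = M (fun x => f x ^+ 2).
Proof.
rewrite /Lpnorm -powR_mulrn ?powR_ge0 // -powRrM mulVf // powRr1.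
  by apply: eq_bigr => x _; rewrite powR_mulrn // real_normK ?num_real.
by apply: prod_mean_ge0 => // x; exact: powR_ge0.
Qed.

(** The variance of [|f|] is nonnegative. *)
Lemma Lpnorm1_sqr_le f : Lpnorm mu 1 f ^+ 2 <= M (fun x => f x ^+ 2).
Proof.
rewrite Lpnorm1E; set c := M (fun x => `|f x|).
have : 0 <= M (fun x => (`|f x| - c) ^+ 2).
  by apply: prod_mean_ge0 => // x; exact: sqr_ge0.
rewrite (_ : (fun x => _) = fun x => (f x ^+ 2 - 2 * c * `|f x|) + c ^+ 2).
  rewrite prod_meanD prod_meanB prod_meanZ prod_mean_cst // -/c; nra.
by apply/funext => x; rewrite -(real_normK (num_real (f x))); ring.
Qed.

Lemma Lpnorm_interpolation p a f : 1 < p < 2 -> 0 <= a <= (2 - p) / p ->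
  Lpnorm mu p f ^+ 2 <=
    (Lpnorm mu 1 f ^+ 2) `^ a * M (fun x => f x ^+ 2) `^ (1 - a).
Proof.
move=> p12 ap; apply: powR_interpolation => //.
- exact: powR_ge0.
- exact: Lpnorm1_sqr_le.
- by apply: prod_mean_ge0 => // x; exact: powR_ge0.
rewrite Lpnorm1E.
have f2 x : 0 <= f x ^+ 2 by exact: sqr_ge0.
have pp : 0 < 2 - p < 1 by lra.
apply: le_trans (hoelder_wsum _ _ _ _ _ (prod_mass_ge0 mu mu_prob)
  (fun x => normr_ge0 (f x)) f2 pp).
apply: ler_sum => x _; rewrite ler_wpM2l ?prod_mass_ge0 //.
by rewrite powR_split //; case/andP: p12.
Qed.

End Norms.

(** * Martingale differences and the noise stability bound *)

(* Conditional expectation given the first [k] coordinates. *)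
Definition Efirst {R : realType} {n : nat} {T : 'I_n -> finType}
    (mu : forall i, T i -> R) (k : nat) (f : Omega T -> R) : Omega T -> R :=
  foldr (Ecoord mu) f (drop k (enum 'I_n)).

Section Martingale.
Context {R : realType} {n : nat} {T : 'I_n -> finType}.
Variables (mu : forall i, T i -> R).
Hypothesis mu_prob : forall i, is_prob (mu i).
Implicit Types (f g h : Omega T -> R).
Local Notation M := (prod_mean mu).
Local Notation E := (Ecoord mu).

Lemma Efirst_full f : Efirst mu n f = f.
Proof. by rewrite /Efirst drop_oversize // size_enum_ord. Qed.

(** Coordinates are numbered from 0, so [Efirst mu i.+1] still depends on coordinate [i]. Applying
    [Lcoord mu i] to it thus gives a martingale difference up to sign. *)
Lemma Efirst_step (i : 'I_n) f : Efirst mu i f = E i (Efirst mu i.+1 f).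
Proof.
by rewrite /Efirst (drop_nth i) ?size_enum_ord // nth_ord_enum.
Qed.

Lemma Ecoord_foldr i s f : E i (foldr E f s) = foldr E (E i f) s.
Proof. by elim: s => //= j s IH; rewrite EcoordC IH. Qed.

Lemma Efirst_Lcoord k i f : Efirst mu k (Lcoord mu i f) = Lcoord mu i (Efirst mu k f).
Proof.
by rewrite /Efirst; elim: drop => //= j s ->; rewrite Ecoord_Lcoord.
Qed.

Lemma semigroup_Efirst t k f : 0 <= t ->
  semigroup mu t (Efirst mu k f) = Efirst mu k (semigroup mu t f).
Proof.
by move=> t0; rewrite /Efirst; elim: drop => //= j s <-; rewrite semigroup_Ecoord.
Qed.

Lemma prod_mean_Efirst k f : M (Efirst mu k f) = M f.
Proof. by rewrite /Efirst; elim: drop => //= j s IH; rewrite prod_mean_Ecoord. Qed.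

(** Each averaging contracts L^1, by the triangle inequality and invariance of the mean. *)
Lemma Lpnorm1_Efirst k f : Lpnorm mu 1 (Efirst mu k f) <= Lpnorm mu 1 f.
Proof.
rewrite /Efirst; elim: drop => [|j s]; first exact: lexx.
rewrite [foldr _ _ (_ :: _)]/=; apply: le_trans.
set g := foldr _ _ _; rewrite !Lpnorm1E //.
apply: (@le_trans _ _ (M (E j (fun x => `|g x|)))); last by rewrite prod_mean_Ecoord.
by apply: le_prod_mean => // x; exact: norm_Ecoord.
Qed.

Lemma Efirst0 f : Efirst mu 0 f = fun=> M f.
Proof.
have inv i x (y : T i) : Efirst mu 0 f (upd x y) = Efirst mu 0 f x.
  rewrite /Efirst drop0; have : i \in enum 'I_n by rewrite mem_enum.
  elim: (enum 'I_n) f => //= j s IH f'; rewrite in_cons => /orP[/eqP <-|/IH{}IH].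
    exact: Ecoord_upd.
  (* The outer average over [j] moves inside onto [f'], so that the induction hypothesis applies. *)
  by rewrite Ecoord_foldr IH.
apply/funext => x; rewrite -(prod_mean_Efirst 0 f).
rewrite -[LHS](prod_mean_cst mu mu_prob); congr M; apply/funext => z.
exact: upd_invariant_cst.
Qed.

(** Pythagoras: [Ecoord mu i] is an orthogonal projection of L^2. *)
Lemma prod_mean_Lcoord_sqr i g : M (fun x => Lcoord mu i g x ^+ 2) =
  M (fun x => g x ^+ 2) - M (fun x => E i g x ^+ 2).
Proof.
have EgE : M (fun x => g x * E i g x) = M (fun x => E i g x ^+ 2).
  rewrite -(prod_mean_Ecoord _ mu_prob i); congr (M _); apply/funext => x.
  by rewrite Ecoord_mull // => z y; rewrite Ecoord_upd.
transitivity (M (fun x => (E i g x ^+ 2 - 2 * (g x * E i g x)) + g x ^+ 2)).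
  by congr (M _); apply/funext => x; rewrite LcoordE; ring.
by rewrite prod_meanD prod_meanB prod_meanZ EgE; ring.
Qed.

(** The second moments of [Efirst mu k f] telescope from the squared mean at [k = 0] to the second
    moment of [f] at [k = n]. *)
Lemma prod_var_martingale f :
  prod_var mu f = \sum_(i < n) M (fun x => Lcoord mu i (Efirst mu i.+1 f) x ^+ 2).
Proof.
pose u k := M (fun x => Efirst mu k f x ^+ 2).
transitivity (u n - u 0%N).
  by rewrite /u Efirst_full Efirst0 prod_mean_cst.
rewrite -telescope_sumr // big_mkord; apply: eq_bigr => i _.
by rewrite prod_mean_Lcoord_sqr -Efirst_step.
Qed.

Lemma prod_var_le f : prod_var mu f <= M (fun x => f x ^+ 2).
Proof. by rewrite gerBl sqr_ge0. Qed.

Lemma noise_stability_le rho (eta : R) f : hypercontractive mu rho ->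
  0 < rho -> 0 < eta < 1 ->
  noise_stability mu eta f <=
    (\sum_(i < n) Lpnorm mu 1 (Lcoord mu i f) ^+ 2) `^ (noise_exponent rho eta)
      * Lpnorm mu 2 f `^ (2 - 2 * noise_exponent rho eta).
Proof.
move=> hyper rho0 /andP[eta0 eta1].
rewrite /noise_stability; set t := noise_time eta; set a := noise_exponent rho eta.
have t0 : 0 < t by rewrite /t /noise_time divr_gt0 // oppr_gt0 ln_lt0 //; lra.
have ea : a = (1 - expR (- (rho * t))) / 2.
  rewrite /a /noise_exponent /powR ifF; last by apply/eqP; lra.
  by congr ((1 - expR _) / 2); rewrite /t /noise_time; field.
set e := expR _ in ea.
have e0 : 0 < e by exact: expR_gt0.
have e1 : e < 1 by rewrite /e expR_lt1 oppr_lt0 mulr_gt0.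
(* The least exponent that hypercontractivity allows for [q = 2], since [e ^+ 2] is
   [expR (- (2 * rho * t))]. *)
pose p := 1 + e ^+ 2.
have pe : 1 + (2 - 1) * expR (- (2 * rho * t)) <= p.
  rewrite /p /e -expRM_natl; have -> : (2 - 1 : R) = 1 by ring.
  by rewrite mul1r le_eqVlt; apply/orP; left; apply/eqP; congr (1 + expR _); ring.
have p12 : 1 < p < 2 by rewrite /p; apply/andP; split; nra.
have [p1 p2] := andP p12.
have a01 : 0 < a < 1 by rewrite ea; apply/andP; split; lra.
have ap : 0 <= a <= (2 - p) / p.
  apply/andP; split; first by case/andP: a01 => /ltW.
  (* With [a = (1 - e) / 2], the difference [2 - p - a p] factors as [1 - e] times
     [1 + e - (1 + e^2) / 2]. *)
  have /mulr_ge0 : 0 <= 1 - e by lra.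
  move=> /(_ (1 + e - (1 + e ^+ 2) / 2)) h; rewrite ler_pdivlMr ?ea /p; last by nra.
  by have := h ltac:(nra); lra.
pose h (i : 'I_n) := Lcoord mu i (Efirst mu i.+1 f).
pose V (i : 'I_n) := M (fun x => h i x ^+ 2).
pose W (i : 'I_n) := Lpnorm mu 1 (Lcoord mu i f) ^+ 2.
have V0 i : 0 <= V i by apply: prod_mean_ge0 => // x; exact: sqr_ge0.
have W0 i : 0 <= W i by exact: sqr_ge0.
have step i : M (fun x => Lcoord mu i (Efirst mu i.+1 (semigroup mu t f)) x ^+ 2)
    <= W i `^ a * V i `^ (1 - a).
  rewrite -semigroup_Efirst ?(ltW t0) // -semigroup_Lcoord ?(ltW t0) //.
  rewrite -(Lpnorm2_sqr mu mu_prob (semigroup mu t (h i))).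
  have hc := hyper t p 2 t0 p1 p2 pe (h i).
  apply: (@le_trans _ _ (Lpnorm mu p (h i) ^+ 2)).
    by apply: (lerXn2r 2 _ _ hc); rewrite nnegrE; exact: powR_ge0.
  apply: (le_trans (Lpnorm_interpolation mu mu_prob p a (h i) p12 ap)).
  have hW : Lpnorm mu 1 (h i) ^+ 2 <= W i.
    apply: lerXn2r; rewrite ?nnegrE; try exact: powR_ge0.
    by rewrite /h -Efirst_Lcoord; exact: Lpnorm1_Efirst.
  apply: ler_wpM2r; first exact: powR_ge0.
  by apply: ge0_ler_powR hW; rewrite ?nnegrE; [case/andP: ap|exact: sqr_ge0..].
rewrite prod_var_martingale.
apply: (@le_trans _ _ (\sum_i 1 * (W i `^ a * V i `^ (1 - a)))).
  by apply: ler_sum => i _; rewrite mul1r.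
apply: (le_trans (hoelder_wsum _ _ _ _ _ (fun=> ler01) W0 V0 a01)).
under eq_bigr do rewrite mul1r.
under [X in _ * X `^ _]eq_bigr do rewrite mul1r.
(* The [V i] sum to the variance of [f], which is at most its squared L^2 norm. *)
rewrite ler_wpM2l ?powR_ge0 // (_ : 2 - 2 * a = 2 * (1 - a)); last by ring.
rewrite powRrM powR_mulrn ?powR_ge0 // Lpnorm2_sqr // /V -prod_var_martingale.
apply: ge0_ler_powR; rewrite ?nnegrE ?prod_var_le //; first by lra.
  by rewrite prod_var_martingale; apply: sumr_ge0 => i _; exact: V0.
by apply: prod_mean_ge0 => // x; exact: sqr_ge0.
Qed.

End Martingale.

(** * The hypercontractivity constant is at most the spectral gap *)

Section SpectralGap.
Context {R : realType} {n : nat} {T : 'I_n -> finType}.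
Variables (mu : forall i, T i -> R).
Hypothesis mu_prob : forall i, is_prob (mu i).
Implicit Types (f g h : Omega T -> R).
Local Notation M := (prod_mean mu).
Local Notation E := (Ecoord mu).

Lemma semigroup_eigen t c f : (forall x, Lgen mu f x = c * f x) ->
  semigroup mu t f = fun x => expR (c * t) * f x.
Proof.
move=> Lf; have Lkf k x : iter k (Lgen mu) f x = c ^+ k * f x.
  elim: k x => [|k IH] x; first by rewrite expr0 mul1r.
  rewrite iterS (_ : iter k _ f = fun x => c ^+ k * f x); last exact/funext.
  rewrite exprSr -mulrA -Lf /Lgen mulr_sumr; apply: eq_bigr => i _.
  rewrite !LcoordE /Ecoord mulrBr; congr (_ - _); rewrite mulr_sumr.
  by apply: eq_bigr => y _; rewrite mulrCA.
apply/funext => x; apply: semigroup_eqP.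
have h : (series (exp_coeff (c * t)) @ \oo --> expR (c * t))%classic.
  exact: is_cvg_series_exp_coeff.
apply: cvg_trans (cvgMr_tmp (b := f x) h); apply: near_eq_cvg; near=> N.
rewrite /series /= mulr_suml; apply: eq_bigr => k _.
by rewrite Lkf /exp_coeff /= exprMn; ring.
Unshelve. all: by end_near. Qed.

(** Otherwise every factor is a point mass, hence so is the product, and all variances vanish. *)
Lemma exists_nontrivial_factor : not_point_mass mu ->
  exists i (y : T i), 0 < mu i y < 1.
Proof.
move=> [g gvar]; apply: contrapT => triv.
have ex i : exists y : T i, 0 < mu i y.
  apply: contrapT => no; have [_] := mu_prob i; rewrite big1 => [|y _].
    by move/eqP; rewrite eq_sym oner_eq0.
  apply/eqP; rewrite eq_le mu_ge0 // andbT leNgt; apply/negP => y0.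
  by apply: no; exists y.
pose z i := sval (cid (ex i)).
have zP i : 0 < mu i (z i) := svalP (cid (ex i)).
have z1 i : mu i (z i) = 1.
  apply/eqP; rewrite eq_le; apply/andP; split.
    have [_ <-] := mu_prob i; rewrite (bigD1 (z i)) //= lerDl.
    by apply: sumr_ge0 => y _; exact: mu_ge0.
  rewrite leNgt; apply/negP => lt1; apply: triv; exists i, (z i).
  by rewrite zP.
pose x0 : Omega T := [ffun i => z i].
have m1 : prod_mass mu x0 = 1.
  by rewrite /prod_mass big1 // => i _; rewrite ffunE.
have m0 x : x != x0 -> prod_mass mu x = 0.
  move=> xx0; apply/eqP; rewrite eq_le prod_mass_ge0 // andbT -(lerD2l 1).
  rewrite addr0 -[X in X + _]m1 -(sum_prod_mass mu mu_prob) (bigD1 x0) //=.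
  rewrite lerD2l (bigD1 x) //= lerDl.
  by apply: sumr_ge0 => w _; exact: prod_mass_ge0.
have Mx0 f : M f = f x0.
  rewrite /prod_mean (bigD1 x0) //= m1 mul1r big1 ?addr0 // => x /m0 ->.
  by rewrite mul0r.
by move/eqP: gvar; apply; rewrite /prod_var !Mx0 subrr.
Qed.

Lemma hypercontractive_gap rho : 0 < rho -> hypercontractive mu rho ->
  not_point_mass mu -> rho <= 1.
Proof.
move=> rho0 hyper /exists_nontrivial_factor[i [y0 /andP[m0 m1]]].
(* Minus the centred indicator of [y0]: it has mean zero in coordinate [i] and ignores the others,
   so [L h = - h]. *)
pose h (x : Omega T) : R := mu i y0 - (x i == y0)%:R.
have h1 x : `|h x| <= 1.
  by rewrite ler_norml /h; case: (x i == y0) => /=; apply/andP; split; lra.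
have Eih x : E i h x = 0.
  rewrite /Ecoord /h; under eq_bigr do rewrite upd_same mulrBr.
  rewrite sumrB -mulr_suml; have [_ ->] := mu_prob i.
  rewrite mul1r (bigD1 y0) //= eqxx mulr1 big1 ?addr0 ?subrr // => y /negPf ->.
  by rewrite mulr0.
have Ejh j : j != i -> E j h = h.
  by move=> ji; apply: Ecoord_invariant => // x y; rewrite /h upd_other.
have Lh x : Lgen mu h x = -1 * h x.
  rewrite /Lgen (bigD1 i) //= LcoordE Eih big1 => [|j ji].
    by rewrite addr0 sub0r mulN1r.
  by rewrite LcoordE Ejh // subrr.
have L1 x : Lgen mu (fun=> 1) x = 0 * 1.
  rewrite mul0r /Lgen big1 // => j _.
  by rewrite LcoordE Ecoord_invariant // subrr.
have Mh : M h = 0.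
  by rewrite -(prod_mean_Ecoord mu mu_prob i) (funext Eih) prod_mean_cst.
set v := M (fun x => h x ^+ 2).
have v1 : v <= 1.
  rewrite -(prod_mean_cst mu mu_prob 1); apply: le_prod_mean => // x.
  by rewrite -(real_normK (num_real (h x))) expr_le1.
have v0 : 0 < v.
  rewrite /v -(prod_mean_Ecoord mu mu_prob i).
  (* Only the term [y = y0] of the average is kept. *)
  apply: (@lt_le_trans _ _ (M (fun=> mu i y0 * (1 - mu i y0) ^+ 2))).
    by rewrite prod_mean_cst // mulr_gt0 // exprn_gt0 // subr_gt0.
  apply: le_prod_mean => // x; rewrite /Ecoord (bigD1 y0) //= /h upd_same eqxx.
  rewrite -sqrrN opprB lerDl; apply: sumr_ge0 => y _.
  by rewrite mulr_ge0 ?mu_ge0 ?sqr_ge0.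
have key t : 0 < t -> expR (- (2 * t)) <= 3 * expR (- (2 * rho * t)).
  move=> t0; set e := expR (- (2 * rho * t)).
  have e0 : 0 < e by exact: expR_gt0.
  have e1 : e < 1 by rewrite /e expR_lt1 oppr_lt0 !mulr_gt0.
  have Pt : semigroup mu t (fun x => 1 - h x) =
      fun x => expR (0 * t) * 1 - expR (-1 * t) * h x.
    rewrite semigroupB ?(ltW t0) //.
    by rewrite (semigroup_eigen _ _ _ L1) (semigroup_eigen _ _ _ Lh).
  pose A := Lpnorm mu 2 (fun x => expR (0 * t) * 1 - expR (-1 * t) * h x).
  pose B := Lpnorm mu (1 + e) (fun x => 1 - h x).
  have AB : A <= B.
    rewrite /A -Pt; apply: hyper; [exact: t0|lra|lra|].
    by rewrite -/e; lra.
  have A2 : A ^+ 2 = 1 + expR (- (2 * t)) * v.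
    rewrite /A Lpnorm2_sqr // mul0r expR0.
    transitivity (M (fun x => (1 - 2 * expR (- t) * h x) +
      expR (- (2 * t)) * h x ^+ 2)).
      congr (M _); apply/funext => x.
      have -> : expR (- (2 * t)) = expR (- t) ^+ 2.
        by rewrite -expRM_natl; congr expR; ring.
      by rewrite mulN1r; ring.
    by rewrite prod_meanD prod_meanB !prod_meanZ prod_mean_cst // Mh mulr0 subr0.
  (* Pointwise, with [u = 1 - h], Bernoulli gives [u^(1 + e) <= u (1 + e (u - 1))], and the term
     linear in [h] integrates to 0. *)
  have Bp : M (fun x => `|1 - h x| `^ (1 + e)) <= 1 + e * v.
    have -> : 1 + e * v = M (fun x => (1 - (1 + e) * h x) + e * h x ^+ 2).
      by rewrite prod_meanD prod_meanB !prod_meanZ prod_mean_cst // Mh mulr0 subr0.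
    apply: le_prod_mean => // x; have := h1 x; rewrite ler_norml => /andP[_ hx].
    have x0 : 0 <= 1 - h x by rewrite subr_ge0.
    rewrite ger0_norm // -mulr_powRB1 //; last by lra.
    have e01 : 0 < e < 1 by rewrite e0.
    have := powR_le1Dx (1 - h x) e x0 e01.
    rewrite (_ : 1 + e - 1 = e); last by ring.
    by move/(ler_wpM2l x0) => hb; apply: (le_trans hb); lra.
  have ev0 : 0 <= e * v by rewrite mulr_ge0 // ltW.
  have ev1 : e * v <= 1 by nra.
  (* The root of order [1 + e] of a number at least 1 is at most that number; [e v <= 1] then bounds
     its square. *)
  have B2 : B ^+ 2 <= 1 + 3 * (e * v).
    apply: (@le_trans _ _ ((1 + e * v) ^+ 2)); last by nra.
    rewrite ler_pXn2r ?nnegrE ?powR_ge0 ?addr_ge0 //.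
    rewrite /B /Lpnorm.
    apply: (@le_trans _ _ ((1 + e * v) `^ (1 + e)^-1)).
      apply: ge0_ler_powR; rewrite ?nnegrE ?invr_ge0 ?addr_ge0 ?(ltW e0) //.
      by apply: prod_mean_ge0 => // x; exact: powR_ge0.
    rewrite -[leRHS]powRr1 ?addr_ge0 //; apply: ler_powR; first by lra.
    by rewrite invf_le1; lra.
  have A0 : 0 <= A by exact: powR_ge0.
  have : A ^+ 2 <= B ^+ 2.
    by apply: (lerXn2r 2 _ _ AB); rewrite nnegrE; exact: powR_ge0.
  move=> AB2; have := le_trans AB2 B2; rewrite A2.
  by rewrite lerD2l mulrA ler_pM2r.
rewrite leNgt; apply/negP => rho1.
have d0 : 0 < rho - 1 by lra.
(* At this time [2 (rho - 1) t = 4], so the estimate reads [expR 4 <= 3], against [expR 4 >= 5]. *)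
have := key (2 / (rho - 1)); rewrite divr_gt0 // => /(_ isT).
set t := 2 / (rho - 1).
have -> : - (2 * t) = 4 + - (2 * rho * t) by rewrite /t; field; rewrite lt0r_neq0.
rewrite expRD ler_pM2r ?expR_gt0 //.
by have := expR_ge1Dx (4 : R); lra.
Qed.

End SpectralGap.

(** * Noise stability bound and lower bound on the exponent *)

Theorem theorem4p1 (R : realType) (n : nat) (T : 'I_n -> finType)
    (mu : forall i : 'I_n, T i -> R) (rho : R)
    (mu_prob : forall i : 'I_n, is_prob (mu i))
    (rho_gt0 : 0 < rho) (hyper : hypercontractive mu rho)
    (f : Omega T -> R) (eta : R) (eta_ge0 : 0 <= eta) (eta_lt1 : eta < 1) :
  noise_stability mu eta f <=
    7 * (\sum_(i < n) Lpnorm mu 1 (Lcoord mu i f) ^+ 2) `^ (noise_exponent rho eta)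
      * Lpnorm mu 2 f `^ (2 - 2 * noise_exponent rho eta)
  /\ (not_point_mass mu -> rho / 4 * eta <= noise_exponent rho eta).
Proof.
split=> [|npm].
  have bound : noise_stability mu eta f <=
      (\sum_(i < n) Lpnorm mu 1 (Lcoord mu i f) ^+ 2) `^ (noise_exponent rho eta)
        * Lpnorm mu 2 f `^ (2 - 2 * noise_exponent rho eta).
    have [eta0|eta_neq0] := eqVneq eta 0; last first.
      by apply: noise_stability_le => //; rewrite eta_lt1 lt0r eta_neq0 eta_ge0.
    (* Hypercontractivity requires a positive time, so [eta = 0] is treated apart. The exponent is
       then 0, any base to the power 0 is 1, and the claim is that the variance is at most the
       second moment. *)
    rewrite /noise_stability /noise_time /noise_exponent eta0 subr0 ln1 oppr0 mul0r.
    rewrite semigroup0 powR1 subrr mul0r mulr0 subr0 powRr0 mul1r.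
    by rewrite powR_mulrn ?powR_ge0 // Lpnorm2_sqr // prod_var_le.
  apply: (le_trans bound); rewrite -mulrA ler_peMl ?mulr_ge0 ?powR_ge0 //; lra.
have rho1 := hypercontractive_gap mu mu_prob rho rho_gt0 hyper npm.
(* The gap bound [rho <= 1] puts [rho / 2] in the range of Bernoulli's inequality. *)
have r01 : 0 < rho / 2 < 1 by lra.
have := powR_le1Dx (1 - eta) (rho / 2) _ r01; rewrite subr_ge0 ltW // => /(_ isT).
by rewrite /noise_exponent; lra.
Qed.
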